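(* Every finite distributive lattice $D$ can be represented as the congruence lattice of a finite planar $3$-modular lattice $L$; that is, for every finite distributive lattice $D$ there is a finite planar $3$-modular lattice $L$ whose congruence lattice is isomorphic to $D$.
   Context: Define lattice polynomials in the variables $x,y,z$ by $p_0=x$, $q_0=y$, $r_0=z$, and $p_{n+1}=p_n\vee(q_n\wedge r_n)$, $q_{n+1}=q_n\vee(p_n\wedge r_n)$, $r_{n+1}=r_n\vee(p_n\wedge q_n)$. For $n>0$, a lattice is $n$-modular if it satisfies the identity $p_n=p_{n+1}$; thus $3$-modular means that $p_3=p_4$ holds identically. A finite lattice is planar if it has a planar Hasse diagram (one drawn without crossing edges). *)

(* Defs.v *)
From HB Require Import structures.
From mathcomp Require Import all_boot all_order all_algebra.
From mathcomp Require Import reals.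
Set Implicit Arguments.
Unset Strict Implicit.
Unset Printing Implicit Defensive.
Import Order.Theory GRing.Theory Num.Theory.

Local Open Scope order_scope.

Section NModular.
Context (d : Order.disp_t) (L : latticeType d).

(* The triple (p_n, q_n, r_n) of lattice polynomials, evaluated at (x, y, z). *)
Fixpoint pqr (n : nat) (x y z : L) : L * L * L :=
  if n is m.+1 then
    let: (p, q, r) := pqr m x y z in
    (p `|` (q `&` r), q `|` (p `&` r), r `|` (p `&` q))
  else (x, y, z).

Definition p_poly (n : nat) (x y z : L) : L := (pqr n x y z).1.1.

End NModular.

Definition n_modular (n : nat) (d : Order.disp_t) (L : latticeType d) : Prop :=
  forall x y z : L, p_poly n x y z = p_poly n.+1 x y z.

Section CongruenceLattice.
Context (d : Order.disp_t) (L : finLatticeType d).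

Definition is_congruence (E : {set L * L}) : bool :=
  [&& [forall x, (x, x) \in E],
      [forall x, forall y, ((x, y) \in E) ==> ((y, x) \in E)],
      [forall x, forall y, forall z,
        ((x, y) \in E) && ((y, z) \in E) ==> ((x, z) \in E)]
    & [forall x1, forall y1, forall x2, forall y2,
        ((x1, y1) \in E) && ((x2, y2) \in E) ==>
        ((x1 `&` x2, y1 `&` y2) \in E) && ((x1 `|` x2, y1 `|` y2) \in E)]].

Record congruence : predArgType :=
  Congruence { cong_set :> {set L * L}; congP : is_congruence cong_set }.

HB.instance Definition _ := [isSub for cong_set].
HB.instance Definition _ := [Finite of congruence by <:].

Lemma is_congruence_bigcap (P : pred {set L * L}) :
  is_congruence (\bigcap_(E : {set L * L} | is_congruence E && P E) E).
Proof.
have H E : is_congruence E -> _ := fun h => and4P h.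
apply/and4P; split.
- apply/forallP=> x; apply/bigcapP=> E /andP[/H[/forallP h _ _ _] _]; exact: h.
- apply/forallP=> x; apply/forallP=> y; apply/implyP=> /bigcapP h.
  apply/bigcapP=> E EP; have /andP[/H[_ s _ _] _] := EP.
  exact: (implyP (forallP (forallP s x) y) (h E EP)).
- apply/forallP=> x; apply/forallP=> y; apply/forallP=> z.
  apply/implyP=> /andP[/bigcapP h1 /bigcapP h2]; apply/bigcapP=> E EP.
  have /andP[/H[_ _ t _] _] := EP.
  apply: (implyP (forallP (forallP (forallP t x) y) z)).
  by rewrite h1 // h2.
- apply/forallP=> x1; apply/forallP=> y1; apply/forallP=> x2; apply/forallP=> y2.
  apply/implyP=> /andP[/bigcapP h1 /bigcapP h2].
  have h E : is_congruence E && P E ->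
      ((x1 `&` x2, y1 `&` y2) \in E) && ((x1 `|` x2, y1 `|` y2) \in E).
    move=> EP; have /andP[/H[_ _ _ c] _] := EP.
    apply: (implyP (forallP (forallP (forallP (forallP c x1) y1) x2) y2)).
    by rewrite h1 // h2.
  by apply/andP; split; apply/bigcapP=> E /h/andP[].
Qed.

Lemma is_congruenceI (E F : congruence) : is_congruence (E :&: F).
Proof.
suff -> : E :&: F = \bigcap_(G : {set L * L} |
    is_congruence G && (G \in [:: E : {set _}; F : {set _}])) G.
  exact: is_congruence_bigcap.
apply/eqP; rewrite eqEsubset; apply/andP; split.
  apply/bigcapsP=> G /andP[_]; rewrite !inE => /orP[]/eqP->.
    exact: subsetIl.
  exact: subsetIr.
by rewrite subsetI !bigcap_inf // congP !inE eqxx ?orbT.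
Qed.

Definition cong_meet (E F : congruence) : congruence :=
  Congruence (is_congruenceI E F).

(* The join is the least congruence containing both. *)
Definition cong_join (E F : congruence) : congruence :=
  Congruence (is_congruence_bigcap (fun G => (E \subset G) && (F \subset G))).

Definition cong_le (E F : congruence) : bool := E \subset F.

Lemma cong_le_refl : reflexive cong_le.
Proof. by move=> E; apply: subxx. Qed.

Lemma cong_le_anti : antisymmetric cong_le.
Proof. by move=> E F h; apply/val_inj/eqP; rewrite eqEsubset. Qed.

Lemma cong_le_trans : transitive cong_le.
Proof. by move=> F E G; apply: subset_trans. Qed.

Fact congruence_display : Order.disp_t. Proof. exact: Order.Disp tt tt. Qed.

HB.instance Definition _ := Order.Le_isPOrder.Build congruence_display
  congruence cong_le_refl cong_le_anti cong_le_trans.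

Lemma cong_meetP (E F G : congruence) :
  (E <= cong_meet F G) = (E <= F) && (E <= G).
Proof. exact: subsetI. Qed.

Lemma cong_joinP (E F G : congruence) :
  (cong_join E F <= G) = (E <= G) && (F <= G).
Proof.
apply/idP/andP=> [h|[EG FG]].
  by split; apply: subset_trans h; apply/bigcapsP=> H /and3P[].
by apply: bigcap_inf; apply/and3P; split; first exact: congP.
Qed.

HB.instance Definition _ := Order.POrder_MeetJoin_isLattice.Build
  congruence_display congruence cong_meetP cong_joinP.

End CongruenceLattice.

Arguments congruence {d} L.

Definition lattice_isomorphic (d1 d2 : Order.disp_t)
    (L1 : latticeType d1) (L2 : latticeType d2) : Prop :=
  exists f : {lmorphism L1 -> L2}, bijective f.

Section Planarity.
Context (R : realType) (d : Order.disp_t) (L : finLatticeType d).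

(* [x] is covered by [y]. *)
Definition covered (x y : L) : bool :=
  (x < y) && [forall z : L, ~~ ((x < z) && (z < y))].

Definition on_segment (u v w : R * R) : Prop :=
  (exists t : R, [/\ 0 <= t, t <= 1,
     w.1 = (1 - t) * u.1 + t * v.1 & w.2 = (1 - t) * u.2 + t * v.2])%R.

(* The edges of the diagram are the straight segments joining the positions of
   x and y for x covered by y; such an edge rises from x to y. *)
Definition hasse_diagram (pos : L -> R * R) : Prop :=
  [/\ injective pos,
      (forall x y : L, covered x y -> ((pos x).2 < (pos y).2)%R)
    & (forall x y z : L, covered x y -> on_segment (pos x) (pos y) (pos z) ->
        z = x \/ z = y)].

(* Distinct edges meet at most in the position of a common endpoint. *)
Definition noncrossing (pos : L -> R * R) : Prop :=
  forall a b a' b' : L, covered a b -> covered a' b' -> (a, b) <> (a', b') ->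
  forall w : R * R,
    on_segment (pos a) (pos b) w -> on_segment (pos a') (pos b') w ->
  exists v : L, [/\ w = pos v, v = a \/ v = b & v = a' \/ v = b'].

Definition planar : Prop :=
  exists pos : L -> R * R, hasse_diagram pos /\ noncrossing pos.

End Planarity.

Arguments planar R {d} L.

(* Main.v *)
Require Import Defs.
From HB Require Import structures.
From mathcomp Require Import all_boot all_order all_algebra.
From mathcomp Require Import reals.
From mathcomp Require Import zify lra.

(** Let J be the poset of join-irreducible elements of D.  Since D is
    isomorphic to the lattice of down-sets of J, it suffices to build a planar
    3-modular lattice whose congruences correspond to the down-sets of J.

    Number the elements of J by 0, ..., n-1 so that larger elements come later,
    and let (p k, q k), k < K, be all the pairs with p k strictly below q k.
    In the grid of columns 0, ..., n and rows 0, ..., 2K, give the edges from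
    column i to column i+1 the color i, the edges from row 2k to row 2k+1 the
    color q k, and those from row 2k+1 to row 2k+2 the color p k.  Two changes
    make the congruences respect the colors and the order of J:
    - for each row edge, a new element is inserted in the cell of the grid
      whose two sides have the color of that edge; this produces a five-element
      diamond, so that row edges and column edges of one color collapse
      together;
    - the points of row 2k+1 to the right of column q k are removed.  The cell
      of color q k then has the two consecutive edges of colors q k and p k as
      its left side and one edge of color q k as its right side, a pentagon,
      so that collapsing q k forces collapsing p k.
    The remaining points are closed under coordinatewise meets and form a
    lattice (staircase); inserting the new elements is a general construction
    (inserted).  That nothing else is forced is theta_congruence: a set of
    colors closed under passing from q k to p k is the set of colors collapsed
    by some congruence.  That a congruence is determined by its collapsed
    colors is theta_sub and sub_theta.

    Planarity holds because the order of this lattice is the coordinatewise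
    order for suitable integer coordinates (plane_order), and such a drawing of
    a lattice has no crossings: if the edges from a to b and from a' to b' meet,
    then a and a' lie below both b and b', so the join of a and a' lies in both
    intervals, and must be an endpoint of each.

    For 3-modularity, call a triple stable if each pairwise meet lies below the
    third entry; the operation (p, q, r) |-> (p v qr, q v pr, r v pq) fixes
    stable triples, and a triple with two comparable entries becomes stable
    after two steps.  In an antichain with y between x and z in the planar
    drawing, xz is below y, and the first step keeps y.  In the lattice above,
    the new first and third entries both lie above y, or above the unique lower
    cover of y if y is an inserted element.  Hence either one of them is
    comparable to y, and two more steps suffice, or both meet y in that lower
    cover and the triple is already stable. *)
Set Implicit Arguments.
Unset Strict Implicit.
Unset Printing Implicit Defensive.
Import Order.Theory GRing.Theory Num.Theory.

Local Open Scope order_scope.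

(** * Lattices embedded in the plane order are planar *)
Section DominanceDrawing.
Context (R : realType) (d : Order.disp_t) (L : finLatticeType d).

Lemma covered_le (x y : L) : covered x y -> x <= y.
Proof. by case/andP=> /ltW. Qed.

Lemma covered_between (x y z : L) :
  covered x y -> x <= z -> z <= y -> z = x \/ z = y.
Proof.
case/andP=> _ /forallP/(_ z) h xz zy.
move: h; rewrite !lt_neqAle xz zy !andbT negb_and !negbK.
by case/orP=> /eqP; [left | right].
Qed.

Variables u v : L -> R.
Hypothesis uvE : forall x y : L, (x <= y) = (u x <= u y)%R && (v x <= v y)%R.

Let uv_inj (x y : L) : u x = u y -> v x = v y -> x = y.
Proof. by move=> hu hv; apply/le_anti; rewrite !uvE hu hv !lexx. Qed.

Let le_uv (x y : L) : x <= y -> (u x <= u y)%R /\ (v x <= v y)%R.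
Proof. by rewrite uvE => /andP. Qed.

(* The shear makes the second coordinate strictly increasing along edges. *)
Let pos (x : L) : R * R := (u x, u x + v x)%R.

Let seg_bounds (x y : L) (w : R * R) : covered x y ->
  on_segment (pos x) (pos y) w ->
  [/\ u x <= w.1, w.1 <= u y, v x <= w.2 - w.1 & w.2 - w.1 <= v y]%R.
Proof.
move=> /covered_le/le_uv[ux vx] [t [t0 t1 /= -> ->]].
by split; nra.
Qed.

Let pos_squeeze (x : L) (w : R * R) : (u x <= w.1)%R -> (w.1 <= u x)%R ->
  (v x <= w.2 - w.1)%R -> (w.2 - w.1 <= v x)%R -> w = pos x.
Proof.
case: w => w1 w2 /= *; rewrite /pos; congr (_, _); lra.
Qed.

Let scaled_le (t s a b c : R) : (0 < t -> t <= s -> a <= c ->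
  (1 - t) * a + t * b = (1 - s) * a + s * c -> c <= b)%R.
Proof.
move=> t_gt0 ts ac e; rewrite -(ler_pM2l t_gt0).
have : (0 <= (s - t) * (c - a))%R by rewrite mulr_ge0 ?subr_ge0.
lra.
Qed.

Let scaled_ge (t s a b c : R) : (t < 1 -> s <= t -> c <= a ->
  (1 - t) * b + t * a = (1 - s) * c + s * a -> b <= c)%R.
Proof.
move=> t_lt1 st ca e; have t'_gt0 : (0 < 1 - t)%R by lra.
rewrite -(ler_pM2l t'_gt0).
have : (0 <= (t - s) * (a - c))%R by rewrite mulr_ge0 ?subr_ge0.
lra.
Qed.

(** Two edges leaving the same point in the same direction end in comparable
    elements, and an element covering x is not above another one. *)
Let shared_bottom (x y z : L) (w : R * R) : covered x y -> covered x z ->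
  on_segment (pos x) (pos y) w -> on_segment (pos x) (pos z) w ->
  w = pos x \/ y = z.
Proof.
move=> cy cz [t [t0 t1 /= w1 w2]] [s [s0 s1 /= w1' w2']].
have [ux vx] := le_uv (covered_le cy); have [ux' vx'] := le_uv (covered_le cz).
have [t_gt0|t_le0] := ltP 0%R t; last first.
  have t_eq0 : t = 0%R by lra.
  left; apply: pos_squeeze; rewrite ?w2 w1 t_eq0; lra.
have [s_gt0|s_le0] := ltP 0%R s; last first.
  have s_eq0 : s = 0%R by lra.
  left; apply: pos_squeeze; rewrite ?w2' w1' s_eq0; lra.
have eu := etrans (esym w1) w1'; have e := etrans (esym w2) w2'.
have ev : ((1 - t) * v x + t * v y = (1 - s) * v x + s * v z)%R by lra.
right; have [ts|st] := leP t s.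
- have zy : z <= y.
    by rewrite uvE (scaled_le t_gt0 ts ux' eu) (scaled_le t_gt0 ts vx' ev).
  case: (covered_between cy (covered_le cz) zy) => // zx.
  by move: cz; rewrite zx /covered ltxx.
- have yz : y <= z.
    rewrite uvE (scaled_le s_gt0 (ltW st) ux (esym eu)).
    by rewrite (scaled_le s_gt0 (ltW st) vx (esym ev)).
  case: (covered_between cz (covered_le cy) yz) => // yx.
  by move: cy; rewrite yx /covered ltxx.
Qed.

Let shared_top (x y z : L) (w : R * R) : covered y x -> covered z x ->
  on_segment (pos y) (pos x) w -> on_segment (pos z) (pos x) w ->
  w = pos x \/ y = z.
Proof.
move=> cy cz [t [t0 t1 /= w1 w2]] [s [s0 s1 /= w1' w2']].
have [ux vx] := le_uv (covered_le cy); have [ux' vx'] := le_uv (covered_le cz).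
have [t_lt1|t_ge1] := ltP t 1%R; last first.
  have t_eq1 : t = 1%R by lra.
  left; apply: pos_squeeze; rewrite ?w2 w1 t_eq1; lra.
have [s_lt1|s_ge1] := ltP s 1%R; last first.
  have s_eq1 : s = 1%R by lra.
  left; apply: pos_squeeze; rewrite ?w2' w1' s_eq1; lra.
have eu := etrans (esym w1) w1'; have e := etrans (esym w2) w2'.
have ev : ((1 - t) * v y + t * v x = (1 - s) * v z + s * v x)%R by lra.
right; have [ts|st] := leP t s.
- have zy : z <= y.
    rewrite uvE (scaled_ge s_lt1 ts ux (esym eu)).
    by rewrite (scaled_ge s_lt1 ts vx (esym ev)).
  case: (covered_between cz zy (covered_le cy)) => // yx.
  by move: cy; rewrite yx /covered ltxx.
- have yz : y <= z.
    rewrite uvE (scaled_ge t_lt1 (ltW st) ux' eu).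
    by rewrite (scaled_ge t_lt1 (ltW st) vx' ev).
  case: (covered_between cy yz (covered_le cz)) => // zx.
  by move: cz; rewrite zx /covered ltxx.
Qed.

(** A common point w of the two edges satisfies a, a' <= w <= b, b'
    coordinatewise, so the join of a and a' lies in both covering intervals and
    is an endpoint of each: the edges share an endpoint. *)
Theorem planar_of_plane_embedding : planar R L.
Proof.
exists pos; split; [split|].
- by move=> x y [hu hv]; apply: uv_inj => //; move: hv; rewrite hu => /addrI.
- move=> x y; case/andP; rewrite lt_neqAle => /andP[neq /le_uv[hu hv]] _ /=.
  rewrite lt_neqAle lerD // andbT; apply: contraNneq neq => e.
  by apply/eqP; apply: uv_inj; apply/eqP; rewrite eq_le ?hu ?hv /=; lra.
- move=> x y z c /(seg_bounds c)[/= h1 h2 h3 h4].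
  by apply: covered_between c _ _; rewrite uvE; apply/andP; split; lra.
move=> a b a' b' c c' neq w s s'.
have [h1 h2 h3 h4] := seg_bounds c s.
have [h1' h2' h3' h4'] := seg_bounds c' s'.
have ab' : a <= b' by rewrite uvE; apply/andP; split; lra.
have a'b : a' <= b by rewrite uvE; apply/andP; split; lra.
have mb : a `|` a' <= b by rewrite leUx (covered_le c).
have mb' : a `|` a' <= b' by rewrite leUx (covered_le c') ab'.
have [ma|ma] := covered_between c (leUl a a') mb;
  have [ma'|ma'] := covered_between c' (leUr a' a) mb'.
- have {ma ma'} e : a' = a by rewrite -ma' ma.
  subst a'; have [->|e] := shared_bottom c c' s s'; last by subst b'.
  by exists a; split=> //; left.
- have {ma ma'} e : b' = a by rewrite -ma' ma.
  subst b'; have wE : w = pos a by apply: pos_squeeze.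
  exists a; split; [exact: wE | by left | by right].
- have {ma ma'} e : a' = b by rewrite -ma' ma.
  subst a'; have wE : w = pos b by apply: pos_squeeze.
  exists b; split; [exact: wE | by right | by left].
- have {ma ma'} e : b' = b by rewrite -ma' ma.
  subst b'; have [->|e] := shared_top c c' s s'; last by subst a'.
  by exists b; split=> //; right.
Qed.

End DominanceDrawing.

(** * A criterion for 3-modularity *)
Section ThreeModular.
Context (d : Order.disp_t) (L : latticeType d).

Definition pqr_step (t : L * L * L) : L * L * L :=
  let: (p, q, r) := t in (p `|` (q `&` r), q `|` (p `&` r), r `|` (p `&` q)).

Definition pqr_stable (t : L * L * L) : bool :=
  let: (p, q, r) := t in [&& q `&` r <= p, p `&` r <= q & p `&` q <= r].

Lemma pqr_step_stable t : pqr_stable t -> pqr_step t = t.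
Proof.
by case: t => [[p q] r] /and3P[*]; rewrite /=; congr (_, _, _); exact: join_l.
Qed.

Definition stable_within3 t := pqr_stable (pqr_step (pqr_step (pqr_step t))).

Lemma n_modular3 :
  (forall x y z : L, stable_within3 (x, y, z)) -> n_modular 3 L.
Proof.
move=> h x y z; rewrite /p_poly.
have E n : pqr n.+1 x y z = pqr_step (pqr n x y z) by [].
by rewrite (E 3) pqr_step_stable // !E; exact: h.
Qed.

Lemma stable_within3_swap12 x y z :
  stable_within3 (x, y, z) = stable_within3 (y, x, z).
Proof.
pose s t : L * L * L := let: (p, q, r) := t in (q, p, r).
have sE t : pqr_step (s t) = s (pqr_step t).
  by case: t => [[p q] r] /=; rewrite (meetC q p).
have stE t : pqr_stable (s t) = pqr_stable t.
  case: t => [[p q] r] /=; rewrite (meetC q p).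
  by rewrite andbA [X in X && _]andbC -andbA.
by rewrite /stable_within3 -[(y, x, z)]/(s (x, y, z)) !sE stE.
Qed.

Lemma stable_within3_swap23 x y z :
  stable_within3 (x, y, z) = stable_within3 (x, z, y).
Proof.
pose s t : L * L * L := let: (p, q, r) := t in (p, r, q).
have sE t : pqr_step (s t) = s (pqr_step t).
  by case: t => [[p q] r] /=; rewrite (meetC r q).
have stE t : pqr_stable (s t) = pqr_stable t.
  by case: t => [[p q] r] /=; rewrite (meetC r q) [X in _ && X]andbC.
by rewrite /stable_within3 -[(x, z, y)]/(s (x, y, z)) !sE stE.
Qed.

(** With x <= y, the second entry stays y and the third becomes x v z; after two
    steps the first entry is their meet. *)
Lemma step2_stable x y z : x <= y ->
  pqr_stable (pqr_step (pqr_step (x, y, z))).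
Proof.
move=> xy; rewrite /= (meet_l xy) [z `|` x]joinC.
have -> : y `|` (x `&` z) = y by rewrite join_l ?leIxl.
set p1 := x `|` (y `&` z); set r1 := x `|` z.
have p1y : p1 <= y by rewrite leUx xy leIl.
have p1r : p1 <= r1 by rewrite leU2 // leIr.
rewrite (meet_l p1r) (join_l p1y) (meet_l p1y) (join_l p1r).
have -> : p1 `|` (y `&` r1) = y `&` r1 by rewrite join_r ?lexI ?p1y.
by rewrite lexx leIxl ?leIl //= leIxl // leIr.
Qed.

Lemma stable_within3_le x y z : x <= y -> stable_within3 (x, y, z).
Proof.
by move=> xy; rewrite /stable_within3 pqr_step_stable; exact: step2_stable.
Qed.

Lemma stable_within3_comparable x y z : x >=< y -> stable_within3 (x, y, z).
Proof.
by case/orP=> h; last rewrite stable_within3_swap12; exact: stable_within3_le.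
Qed.

Lemma stable_within3_stable t : pqr_stable (pqr_step t) -> stable_within3 t.
Proof. by move=> st; rewrite /stable_within3 !(pqr_step_stable st). Qed.

Lemma stable_within3_12 t : (pqr_step t).1.1 <= (pqr_step t).1.2 ->
  stable_within3 t.
Proof.
rewrite /stable_within3; case: (pqr_step t) => [[p q] r].
exact: step2_stable.
Qed.

Lemma stable_within3_sort x y z (u : L -> nat) :
  (forall x y z : L, (u x <= u y <= u z)%N -> stable_within3 (x, y, z)) ->
  stable_within3 (x, y, z).
Proof.
move=> h; wlog xy : x y z / (u x <= u y)%N => [H|].
  by case/orP: (leq_total (u x) (u y)) => ?; last rewrite stable_within3_swap12;
    exact: H.
case/orP: (leq_total (u y) (u z)) => yz; first by apply: h; rewrite xy.
rewrite stable_within3_swap23.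
case/orP: (leq_total (u x) (u z)) => xz; first by apply: h; rewrite xz.
by rewrite stable_within3_swap12; apply: h; rewrite xz.
Qed.

(** Here u and v are the coordinates of an order embedding in the plane; for
    incomparable elements, larger u means further to the right and larger v
    further to the left.  The element lo x is x itself or a unique lower cover
    of x; the last two hypotheses say that the meet of x with an element on one
    side of x is not behind lo x in the coordinate that grows towards that
    side. *)
Section PlaneLattice.
Variables u v : L -> nat.
Hypothesis uvE : forall x y : L, (x <= y) = (u x <= u y)%N && (v x <= v y)%N.
Variable lo : L -> L.
Hypothesis lo_le : forall x, lo x <= x.
Hypothesis meet_lo : forall x y, ~~ (x <= y) -> x `&` y <= lo x.
Hypothesis meet_right : forall x y, x >< y -> (u x < u y)%N ->
  (u (lo x) <= u (x `&` y))%N.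
Hypothesis meet_left : forall x y, x >< y -> (v x < v y)%N ->
  (v (lo x) <= v (x `&` y))%N.

Lemma n_modular3_plane : n_modular 3 L.
Proof.
have le_uv (x y : L) : x <= y -> (u x <= u y)%N /\ (v x <= v y)%N.
  by rewrite uvE => /andP.
apply: n_modular3 => x y z; apply: (@stable_within3_sort _ _ _ u).
move=> {}x {}y {}z /andP[uxy uyz].
have [cxy|nxy] := boolP (x >=< y); first exact: stable_within3_comparable.
have [cyz|nyz] := boolP (z >=< y).
  rewrite stable_within3_swap23 stable_within3_swap12 stable_within3_swap23.
  exact: stable_within3_comparable.
have vyx : (v y < v x)%N.
  rewrite ltnNge; apply: contra nxy => h.
  by rewrite /Order.comparable uvE uxy h.
have vzy : (v z < v y)%N.
  rewrite ltnNge; apply: contra nyz => h.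
  by rewrite /Order.comparable orbC uvE uyz h.
have uxy' : (u x < u y)%N.
  rewrite ltnNge; apply: contra nxy => h.
  by rewrite /Order.comparable [y <= x]uvE h (ltnW vyx) orbT.
have uyz' : (u y < u z)%N.
  rewrite ltnNge; apply: contra nyz => h.
  by rewrite /Order.comparable [z <= y]uvE h (ltnW vzy).
(* y lies between x and z, so it is above their meet. *)
have qE : y `|` (x `&` z) = y.
  have [ux _] := le_uv _ _ (leIl x z); have [_ vz] := le_uv _ _ (leIr z x).
  by apply: join_l; rewrite uvE; lia.
pose p1 := x `|` (y `&` z); pose r1 := z `|` (x `&` y).
have [_ xp] := le_uv x p1 (leUl _ _); have [zr _] := le_uv z r1 (leUl _ _).
have [lou lov] := le_uv _ _ (lo_le y).
have lop : lo y <= p1.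
  have nyz' : y >< z by rewrite comparable_sym.
  have [h _] := le_uv _ _ (leUr (y `&` z) x : y `&` z <= p1).
  by rewrite uvE; move: (meet_right nyz' uyz'); lia.
have lor : lo y <= r1.
  have nxy' : y >< x by rewrite comparable_sym.
  have [_] := le_uv _ _ (leUr (x `&` y) z : x `&` y <= r1).
  by rewrite uvE meetC; move: (meet_left nxy' vyx); lia.
(* If y is below neither p1 nor r1, it meets both of them in lo y. *)
have [yp|nyp] := boolP (y <= p1).
  by rewrite stable_within3_swap12; apply: stable_within3_12; rewrite /= qE.
have [yr|nyr] := boolP (y <= r1).
  rewrite stable_within3_swap23 stable_within3_swap12 stable_within3_swap23.
  rewrite stable_within3_swap12; apply: stable_within3_12.
  by rewrite /= (meetC z x) (meetC y x) qE.
apply: stable_within3_stable; rewrite /= qE -/p1 -/r1.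
apply/and3P; split.
- by apply: le_trans lop; exact: meet_lo.
- have below w : w <= p1 -> w <= r1 -> w <= y.
    by move: nyp nyr; rewrite !uvE; lia.
  by apply: below; rewrite ?leIl ?leIr.
- by rewrite meetC; apply: le_trans lor; exact: meet_lo.
Qed.

End PlaneLattice.

End ThreeModular.

(** * Congruences of finite lattices *)
Section CongruenceFacts.
Context (d : Order.disp_t) (L : finLatticeType d).

(** Compatibility in one argument is enough: two changes can be made one after
    the other. *)
Lemma is_congruenceP (E : {set L * L}) : reflect
  [/\ forall x, (x, x) \in E,
      forall x y, (x, y) \in E -> (y, x) \in E,
      forall x y z, (x, y) \in E -> (y, z) \in E -> (x, z) \in E,
      forall x y z, (x, y) \in E -> (x `&` z, y `&` z) \in E
    & forall x y z, (x, y) \in E -> (x `|` z, y `|` z) \in E]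
  (is_congruence E).
Proof.
apply: (iffP and4P) => [[/forallP r s t c]|[r s t m j]].
  have c' x y z : (x, y) \in E ->
      ((x `&` z, y `&` z) \in E) && ((x `|` z, y `|` z) \in E).
    move=> xy.
    apply: (implyP (forallP (forallP (forallP (forallP c x) y) z) z)).
    by rewrite xy r.
  split=> //.
  - by move=> x y; exact: (implyP (forallP (forallP s x) y)).
  - move=> x y z xy yz.
    by apply: (implyP (forallP (forallP (forallP t x) y) z)); rewrite xy.
  - by move=> x y z /(c' x y z)/andP[].
  - by move=> x y z /(c' x y z)/andP[].
split.
- exact/forallP.
- by apply/forallP=> x; apply/forallP=> y; apply/implyP; exact: s.
- apply/forallP=> x; apply/forallP=> y; apply/forallP=> z.
  by apply/implyP=> /andP[]; exact: t.
- apply/forallP=> x1; apply/forallP=> y1.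
  apply/forallP=> x2; apply/forallP=> y2.
  apply/implyP=> /andP[h1 h2]; apply/andP; split.
    apply: t (m _ _ x2 h1) _.
    by rewrite meetC [X in (_, X)]meetC; exact: m.
  apply: t (j _ _ x2 h1) _.
  by rewrite joinC [X in (_, X)]joinC; exact: j.
Qed.

Variable E : {set L * L}.
Hypothesis congE : is_congruence E.

Lemma cong_refl x : (x, x) \in E.
Proof. by have /is_congruenceP[] := congE. Qed.

Lemma cong_sym x y : (x, y) \in E -> (y, x) \in E.
Proof. by have /is_congruenceP[] := congE => _ + _ _ _; apply. Qed.

Lemma cong_trans y x z : (x, y) \in E -> (y, z) \in E -> (x, z) \in E.
Proof. by have /is_congruenceP[] := congE => _ _ + _ _; apply. Qed.

Lemma cong_meetr z x y : (x, y) \in E -> (x `&` z, y `&` z) \in E.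
Proof. by have /is_congruenceP[] := congE => _ _ _ + _; apply. Qed.

Lemma cong_joinr z x y : (x, y) \in E -> (x `|` z, y `|` z) \in E.
Proof. by have /is_congruenceP[] := congE => _ _ _ _; apply. Qed.

Lemma cong_meetl z x y : (x, y) \in E -> (z `&` x, z `&` y) \in E.
Proof. by rewrite ![z `&` _]meetC; exact: cong_meetr. Qed.

Lemma cong_joinl z x y : (x, y) \in E -> (z `|` x, z `|` y) \in E.
Proof. by rewrite ![z `|` _]joinC; exact: cong_joinr. Qed.

Lemma cong_join2 x y x' y' : (x, y) \in E -> (x', y') \in E ->
  (x `|` x', y `|` y') \in E.
Proof. by move=> /(cong_joinr x') h /(cong_joinl y); exact: cong_trans h. Qed.

Lemma cong_interval x y a b : x <= a -> a <= y -> x <= b -> b <= y ->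
  (x, y) \in E -> (a, b) \in E.
Proof.
move=> xa ay xb yb xy.
have xE z : x <= z -> z <= y -> (x, z) \in E.
  by move=> xz zy; move: (cong_meetr z xy); rewrite (meet_l xz) (meet_r zy).
by apply: cong_trans (xE b _ _) => //; apply: cong_sym; exact: xE.
Qed.

End CongruenceFacts.

(** * Inserting new elements into intervals of a lattice *)
Fact inserted_display : Order.disp_t. Proof. exact: Order.Disp tt tt. Qed.

Section Insertion.
Context (d : Order.disp_t) (S : finTBLatticeType d) (M : finType).
Variables (lo hi : M -> S).

(** Each m in M becomes a new element whose only lower cover is lo m and whose
    only upper cover is hi m.  The proof that lo m < hi m is a parameter of the
    type so that the order can be attached to it. *)
Definition inserted (_ : forall m, lo m < hi m) : Type := (S + M)%type.

Hypothesis lohi : forall m, lo m < hi m.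
Local Notation L := (inserted lohi).

HB.instance Definition _ := Finite.copy L (S + M)%type.

Definition old (s : S) : L := inl s.
Definition new (m : M) : L := inr m.

(** For an old element both are the element itself; an element of S is below x
    exactly if it is below floor x, and above x exactly if it is above
    ceil x. *)
Definition floor (x : L) : S := match x with inl s => s | inr m => lo m end.
Definition ceil (x : L) : S := match x with inl s => s | inr m => hi m end.

Definition inserted_le (x y : L) := (x == y) || (ceil x <= floor y).

Lemma floor_le_ceil x : floor x <= ceil x.
Proof. by case: x => //= m; exact: ltW. Qed.

Lemma ceil_le_floor x : ceil x <= floor x -> x = old (floor x).
Proof. by case: x => //= m; rewrite lt_geF ?lohi. Qed.

Lemma inserted_le_floor x y : inserted_le x y -> floor x <= floor y.
Proof. by case/orP=> [/eqP->//|]; apply: le_trans; exact: floor_le_ceil. Qed.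

Lemma inserted_le_ceil x y : inserted_le x y -> ceil x <= ceil y.
Proof.
by case/orP=> [/eqP->//|h]; apply: le_trans h _; exact: floor_le_ceil.
Qed.

Lemma inserted_le_refl : reflexive inserted_le.
Proof. by move=> x; rewrite /inserted_le eqxx. Qed.

Lemma inserted_le_anti : antisymmetric inserted_le.
Proof.
move=> x y /andP[]; rewrite {1}/inserted_le => /orP[/eqP//|xy] yx.
have xx : ceil x <= floor x by exact: le_trans xy (inserted_le_floor yx).
have yy : ceil y <= floor y by exact: le_trans (inserted_le_ceil yx) xy.
rewrite (ceil_le_floor xx) (ceil_le_floor yy); congr old.
apply/le_anti; rewrite (inserted_le_floor yx) andbT.
exact: le_trans (floor_le_ceil x) xy.
Qed.

Lemma inserted_le_trans : transitive inserted_le.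
Proof.
move=> y x z /orP[/eqP->//|xy] yz; apply/orP; right.
exact: le_trans xy (inserted_le_floor yz).
Qed.

HB.instance Definition _ := Order.Le_isPOrder.Build inserted_display L
  inserted_le_refl inserted_le_anti inserted_le_trans.

Lemma inserted_leE (x y : L) : (x <= y) = (x == y) || (ceil x <= floor y).
Proof. by []. Qed.

Lemma le_old (x : L) (s : S) : (x <= old s) = (ceil x <= s).
Proof. by rewrite inserted_leE; case: eqP => [->/=|//]; rewrite lexx. Qed.

Lemma old_le (x : L) (s : S) : (old s <= x) = (s <= floor x).
Proof. by rewrite inserted_leE; case: eqP => [<-/=|//]; rewrite lexx. Qed.

Definition inserted_meet (x y : L) : L :=
  if x <= y then x else if y <= x then y else old (floor x `&` floor y).

Definition inserted_join (x y : L) : L :=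
  if x <= y then y else if y <= x then x else old (ceil x `|` ceil y).

Lemma inserted_meetP (z x y : L) :
  (z <= inserted_meet x y) = (z <= x) && (z <= y).
Proof.
rewrite /inserted_meet; case: ifP => [xy|xy].
  by case: (boolP (z <= x)) => //= zx; rewrite (le_trans zx xy).
case: ifP => [yx|yx].
  by rewrite andbC; case: (boolP (z <= y)) => //= zy; rewrite (le_trans zy yx).
rewrite le_old lexI; apply/idP/andP => [/andP[zx zy]|[zx zy]].
  by rewrite !inserted_leE zx zy !orbT.
have /negbTE nzx : z != x by apply: contraFneq xy => <-.
have /negbTE nzy : z != y by apply: contraFneq yx => <-.
by move: zx zy; rewrite !inserted_leE nzx nzy /= => -> ->.
Qed.

Lemma inserted_joinP (x y z : L) :
  (inserted_join x y <= z) = (x <= z) && (y <= z).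
Proof.
rewrite /inserted_join; case: ifP => [xy|xy].
  by rewrite andbC; case: (boolP (y <= z)) => //= yz; rewrite (le_trans xy yz).
case: ifP => [yx|yx].
  by case: (boolP (x <= z)) => //= xz; rewrite (le_trans yx xz).
rewrite old_le leUx; apply/idP/andP => [/andP[zx zy]|[zx zy]].
  by rewrite !inserted_leE zx zy !orbT.
have /negbTE nzx : x != z by apply: contraFneq yx => ->.
have /negbTE nzy : y != z by apply: contraFneq xy => ->.
by move: zx zy; rewrite !inserted_leE nzx nzy /= => -> ->.
Qed.

HB.instance Definition _ := Order.POrder_MeetJoin_isLattice.Build
  inserted_display L inserted_meetP inserted_joinP.

Lemma inserted_le0x (x : L) : old \bot <= x.
Proof. by rewrite old_le le0x. Qed.

Lemma inserted_lex1 (x : L) : x <= old \top.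
Proof. by rewrite le_old lex1. Qed.

HB.instance Definition _ :=
  Order.hasBottom.Build inserted_display L inserted_le0x.
HB.instance Definition _ :=
  Order.hasTop.Build inserted_display L inserted_lex1.

Lemma meet_incomparable (x y : L) : x >< y ->
  x `&` y = old (floor x `&` floor y).
Proof.
rewrite negb_or => /andP[/negbTE xy /negbTE yx].
by rewrite [LHS]/(inserted_meet x y) /inserted_meet xy yx.
Qed.

Lemma join_incomparable (x y : L) : x >< y ->
  x `|` y = old (ceil x `|` ceil y).
Proof.
rewrite negb_or => /andP[/negbTE xy /negbTE yx].
by rewrite [LHS]/(inserted_join x y) /inserted_join xy yx.
Qed.

Lemma meet_old s t : old s `&` old t = old (s `&` t).
Proof.
have E z : (z <= old s `&` old t) = (z <= old (s `&` t)).
  by rewrite lexI !le_old lexI.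
by apply/le_anti; rewrite -E lexx E lexx.
Qed.

Lemma join_old s t : old s `|` old t = old (s `|` t).
Proof.
have E z : (old s `|` old t <= z) = (old (s `|` t) <= z).
  by rewrite leUx !old_le leUx.
by apply/le_anti; rewrite E lexx -E lexx.
Qed.

Lemma meet_le_floor (x y : L) : ~~ (x <= y) -> x `&` y <= old (floor x).
Proof.
move=> nxy; rewrite le_old; have le_x : x `&` y <= x by rewrite leIl.
rewrite inserted_leE in le_x; case/orP: le_x => // /eqP xy.
by rewrite leEmeet xy eqxx in nxy.
Qed.

(** A congruence E of S extends to the new elements if it treats each m in one
    of two ways.  Either it identifies lo m and hi m, and m joins their class;
    or m stays alone.  In the second case a class containing lo m must not
    contain anything that is not below m, as its join with m would be identified
    with m; dually for hi m. *)
Section Extension.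
Variable E : {set S * S}.
Hypothesis congE : is_congruence E.
Hypothesis tight : forall m, (lo m, hi m) \in E \/
  ((forall s, (s, lo m) \in E -> s <= lo m) /\
   (forall s, (s, hi m) \in E -> hi m <= s)).

Definition flat (x : L) := (floor x, ceil x) \in E.

Definition extension : {set L * L} :=
  [set xy | (xy.1 == xy.2) ||
            [&& flat xy.1, flat xy.2 & (floor xy.1, floor xy.2) \in E]].

Lemma extensionE x y : (x, y) \in extension =
  (x == y) || [&& flat x, flat y & (floor x, floor y) \in E].
Proof. by rewrite inE. Qed.

Lemma flat_old s : flat (old s).
Proof. exact: cong_refl. Qed.

Lemma flat_meet x y : flat x -> flat y ->
  flat (x `&` y) /\ (floor (x `&` y), floor x `&` floor y) \in E.
Proof.
move=> fx fy; have [c|n] := boolP (x >=< y); last first.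
  by rewrite meet_incomparable //; split; [exact: flat_old | exact: cong_refl].
case/orP: c => h; rewrite ?(meet_l h) ?(meet_r h).
  by rewrite (meet_l (inserted_le_floor h)); split=> //; exact: cong_refl.
by rewrite (meet_r (inserted_le_floor h)); split=> //; exact: cong_refl.
Qed.

Lemma flat_join x y : flat x -> flat y ->
  flat (x `|` y) /\ (floor (x `|` y), floor x `|` floor y) \in E.
Proof.
move=> fx fy; have [c|n] := boolP (x >=< y); last first.
  rewrite join_incomparable //; split; first exact: flat_old.
  by apply: cong_sym => //; exact: cong_join2.
case/orP: c => h; rewrite ?(join_l h) ?(join_r h).
  by rewrite (join_r (inserted_le_floor h)); split=> //; exact: cong_refl.
by rewrite (join_l (inserted_le_floor h)); split=> //; exact: cong_refl.
Qed.

Lemma flat_meet_new m x : flat x -> ~~ (new m <= x) ->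
  flat (x `&` new m) /\ (floor (x `&` new m), floor x `&` lo m) \in E.
Proof.
move=> fx nx; have [h|n] := boolP (x <= new m).
  rewrite (meet_l h) (meet_l (inserted_le_floor h)).
  by split=> //; exact: cong_refl.
rewrite meet_incomparable; last by rewrite /Order.comparable negb_or n nx.
by split; [exact: flat_old | exact: cong_refl].
Qed.

Lemma flat_join_new m x : flat x -> ~~ flat (new m) -> ~~ (x <= new m) ->
  flat (x `|` new m) /\ (floor (x `|` new m), floor x `|` hi m) \in E.
Proof.
move=> fx nf nx; have [h|n] := boolP (new m <= x).
  rewrite (join_l h) join_l; first by split=> //; exact: cong_refl.
  by case/orP: h nf => [/eqP->|//]; rewrite fx.
rewrite join_incomparable; last by rewrite /Order.comparable negb_or n nx.
split; first exact: flat_old.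
by apply: cong_sym => //; exact: cong_joinr.
Qed.

Lemma extension_congruence : is_congruence extension.
Proof.
have sy := cong_sym congE; have tr := cong_trans congE.
have symE x y : (x, y) \in extension -> (y, x) \in extension.
  rewrite !extensionE eq_sym => /orP[->//|/and3P[-> -> /sy->]].
  by rewrite orbT.
apply/is_congruenceP; split=> //.
- by move=> x; rewrite extensionE eqxx.
- move=> x y z; rewrite !extensionE => /orP[/eqP->//|/and3P[fx fy xy]].
  case/orP=> [/eqP<-|/and3P[_ fz yz]]; first by rewrite fx fy xy orbT.
  by rewrite fx fz (tr _ _ _ xy yz) orbT.
- move=> x y z; rewrite !extensionE => /orP[/eqP->|/and3P[fx fy xy]].
    by rewrite eqxx.
  have [fz|] := boolP (flat z).
    have [f1 e1] := flat_meet fx fz; have [f2 e2] := flat_meet fy fz.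
    rewrite f1 f2 (tr _ _ _ (tr _ _ _ e1 _) (sy _ _ e2)) ?orbT //.
    exact: cong_meetr.
  case: z => [s|m]; first by rewrite flat_old.
  rewrite -/(new m) => nf; have [|[maxlo minhi]] := tight m.
    by move=> h; rewrite /flat h in nf.
  have up a b : flat a -> flat b -> (floor a, floor b) \in E ->
      new m <= a -> new m <= b.
    move=> fa fb ab; rewrite !inserted_leE => /orP[/eqP ma|ma].
      by rewrite ma fa in nf.
    suff : hi m <= hi m `&` floor b.
      by rewrite lexI => /andP[_ ->]; rewrite orbT.
    apply: minhi; apply: sy.
    by move: (cong_meetl congE (hi m) ab); rewrite (meet_l ma).
  have [mx|nmx] := boolP (new m <= x).
    by rewrite (meet_r mx) (meet_r (up _ _ fx fy xy mx)) eqxx.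
  have nmy : ~~ (new m <= y) by apply: contra nmx; exact: up (sy _ _ xy).
  have [f1 e1] := flat_meet_new fx nmx.
  have [f2 e2] := flat_meet_new fy nmy.
  rewrite f1 f2 (tr _ _ _ (tr _ _ _ e1 _) (sy _ _ e2)) ?orbT //.
  exact: cong_meetr.
- move=> x y z; rewrite !extensionE => /orP[/eqP->|/and3P[fx fy xy]].
    by rewrite eqxx.
  have [fz|] := boolP (flat z).
    have [f1 e1] := flat_join fx fz; have [f2 e2] := flat_join fy fz.
    rewrite f1 f2 (tr _ _ _ (tr _ _ _ e1 _) (sy _ _ e2)) ?orbT //.
    exact: cong_joinr.
  case: z => [s|m]; first by rewrite flat_old.
  rewrite -/(new m) => nf; have [|[maxlo minhi]] := tight m.
    by move=> h; rewrite /flat h in nf.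
  have down a b : flat a -> flat b -> (floor a, floor b) \in E ->
      a <= new m -> b <= new m.
    move=> fa fb ab; rewrite !inserted_leE => /orP[/eqP ma|ma].
      by rewrite -ma fa in nf.
    have cab : (ceil a, ceil b) \in E by exact: tr (tr _ _ _ (sy _ _ fa) ab) fb.
    suff : lo m `|` ceil b <= lo m.
      by rewrite leUx => /andP[_ ->]; rewrite orbT.
    apply: maxlo; apply: sy.
    by move: (cong_joinl congE (lo m) cab); rewrite (join_l ma).
  have [xm|nxm] := boolP (x <= new m).
    by rewrite (join_r xm) (join_r (down _ _ fx fy xy xm)) eqxx.
  have nym : ~~ (y <= new m) by apply: contra nxm; exact: down (sy _ _ xy).
  have [f1 e1] := flat_join_new fx nf nxm.
  have [f2 e2] := flat_join_new fy nf nym.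
  rewrite f1 f2 (tr _ _ _ (tr _ _ _ e1 _) (sy _ _ e2)) ?orbT //.
  exact: cong_joinr.
Qed.

End Extension.

End Insertion.

(** * The grid with partially removed rows *)
Fact staircase_display : Order.disp_t. Proof. exact: Order.Disp tt tt. Qed.

Section Staircase.
Variables (n K : nat) (q : nat -> nat).

(** For every k, the odd row 2k+1 ends at column q k. *)
Definition removed (i j : nat) : bool := odd j && (q j./2 < i)%N.

Definition staircase : Type :=
  {x : 'I_n.+1 * 'I_K.*2.+1 | ~~ removed x.1 x.2}.

HB.instance Definition _ :=
  Finite.copy staircase {x : 'I_n.+1 * 'I_K.*2.+1 | ~~ removed x.1 x.2}.

Definition col (x : staircase) : nat := (val x).1.
Definition row (x : staircase) : nat := (val x).2.

Definition in_staircase (i j : nat) : bool :=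
  [&& i <= n, j <= K.*2 & ~~ removed i j]%N.

(* The default value of pt, used outside the staircase. *)
Definition corner : staircase := exist _ (ord0, ord0) isT.

Definition pt (i j : nat) : staircase := insubd corner (inord i, inord j).

Lemma in_staircaseP (x : staircase) : in_staircase (col x) (row x).
Proof.
apply/and3P; split; last exact: (valP x).
- by rewrite -ltnS; exact: ltn_ord.
- by rewrite -ltnS; exact: ltn_ord.
Qed.

Lemma pt_val i j : in_staircase i j -> val (pt i j) = (inord i, inord j).
Proof.
by case/and3P=> hi hj ok; rewrite val_insubd /= !inordK ?ltnS // ok.
Qed.

Lemma col_pt i j : in_staircase i j -> col (pt i j) = i.
Proof. by move=> h; rewrite /col pt_val //= inordK; case/and3P: h. Qed.

Lemma row_pt i j : in_staircase i j -> row (pt i j) = j.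
Proof. by move=> h; rewrite /row pt_val //= inordK; case/and3P: h. Qed.

Lemma staircase_eq x y : col x = col y -> row x = row y -> x = y.
Proof.
move=> hc hr; apply: val_inj; move: hc hr; rewrite /col /row.
case: (val x) (val y) => [a b] [a' b'] /= ha hb.
by congr (_, _); exact: val_inj.
Qed.

Lemma pt_eta x : pt (col x) (row x) = x.
Proof.
by apply: staircase_eq; rewrite ?col_pt ?row_pt ?in_staircaseP.
Qed.

Definition staircase_le (x y : staircase) : bool :=
  (col x <= col y)%N && (row x <= row y)%N.

Lemma staircase_le_refl : reflexive staircase_le.
Proof. by move=> x; rewrite /staircase_le !leqnn. Qed.

Lemma staircase_le_anti : antisymmetric staircase_le.
Proof.
by move=> x y; rewrite /staircase_le => h; apply: staircase_eq; lia.
Qed.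

Lemma staircase_le_trans : transitive staircase_le.
Proof. by move=> y x z; rewrite /staircase_le; lia. Qed.

HB.instance Definition _ := Order.Le_isPOrder.Build staircase_display staircase
  staircase_le_refl staircase_le_anti staircase_le_trans.

Lemma staircase_leE (x y : staircase) :
  (x <= y) = (col x <= col y)%N && (row x <= row y)%N.
Proof. by []. Qed.

(** The join in the staircase is the coordinatewise maximum, unless that point
    has been removed; then the next row up, which is even and hence complete,
    contains the join. *)
Definition lift_row (i j : nat) : nat := if removed i j then j.+1 else j.

Lemma lift_row_in i j : (i <= n)%N -> (j <= K.*2)%N ->
  in_staircase i (lift_row i j).
Proof.
rewrite /in_staircase /lift_row => -> hj.
have [/andP[oj _]|nr] := ifPn; last by rewrite hj nr.
by rewrite /removed /= oj /= andbT; lia.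
Qed.

Lemma in_staircase_min i j i' j' : in_staircase i j -> in_staircase i' j' ->
  in_staircase (minn i i') (minn j j').
Proof.
move=> /and3P[hi hj nr] /and3P[hi' hj' nr']; apply/and3P; split; try lia.
case: (leqP j j') => _; [move: nr|move: nr']; apply: contra;
  by rewrite /removed; case/andP=> ->; lia.
Qed.

Definition staircase_meet (x y : staircase) : staircase :=
  pt (minn (col x) (col y)) (minn (row x) (row y)).

Definition staircase_join (x y : staircase) : staircase :=
  let i := maxn (col x) (col y) in pt i (lift_row i (maxn (row x) (row y))).

Lemma col_meet x y : col (staircase_meet x y) = minn (col x) (col y).
Proof. by rewrite col_pt ?in_staircase_min ?in_staircaseP. Qed.

Lemma row_meet x y : row (staircase_meet x y) = minn (row x) (row y).
Proof. by rewrite row_pt ?in_staircase_min ?in_staircaseP. Qed.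

Lemma in_staircase_join x y : in_staircase (maxn (col x) (col y))
  (lift_row (maxn (col x) (col y)) (maxn (row x) (row y))).
Proof.
have /and3P[hi hj _] := in_staircaseP x.
have /and3P[hi' hj' _] := in_staircaseP y.
by apply: lift_row_in; rewrite geq_max ?hi ?hj.
Qed.

Lemma col_join x y : col (staircase_join x y) = maxn (col x) (col y).
Proof. by rewrite col_pt ?in_staircase_join. Qed.

Lemma row_join x y : row (staircase_join x y) =
  lift_row (maxn (col x) (col y)) (maxn (row x) (row y)).
Proof. by rewrite row_pt ?in_staircase_join. Qed.

(** If (i, j) is removed, then row j has no point in column i or further right,
    so points there that are above row j are also above row j+1. *)
Lemma lift_row_le i j x : (i <= col x)%N ->
  (lift_row i j <= row x)%N = (j <= row x)%N.
Proof.
move=> hi; rewrite /lift_row; case: ifPn => // /andP[oj qi].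
apply/idP/idP=> [/ltnW//|]; rewrite leq_eqVlt => /predU1P[e|//].
have /and3P[_ _] := in_staircaseP x; rewrite /removed -e oj /=; lia.
Qed.

Lemma staircase_meetP (x y z : staircase) :
  (x <= staircase_meet y z) = (x <= y) && (x <= z).
Proof. by rewrite !staircase_leE col_meet row_meet; lia. Qed.

Lemma staircase_joinP (x y z : staircase) :
  (staircase_join x y <= z) = (x <= z) && (y <= z).
Proof.
rewrite !staircase_leE col_join row_join.
have [h|h] := leqP (maxn (col x) (col y)) (col z); last by lia.
by rewrite lift_row_le //; lia.
Qed.

HB.instance Definition _ := Order.POrder_MeetJoin_isLattice.Build
  staircase_display staircase staircase_meetP staircase_joinP.

Lemma corner_le (x : staircase) : corner <= x.
Proof. by []. Qed.

Lemma in_staircase_top : in_staircase n K.*2.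
Proof. by rewrite /in_staircase /removed odd_double !leqnn. Qed.

Lemma le_top (x : staircase) : x <= pt n K.*2.
Proof.
have /and3P[hi hj _] := in_staircaseP x.
by rewrite staircase_leE col_pt ?row_pt ?in_staircase_top ?hi.
Qed.

HB.instance Definition _ :=
  Order.hasBottom.Build staircase_display staircase corner_le.
HB.instance Definition _ :=
  Order.hasTop.Build staircase_display staircase le_top.

Lemma colI (x y : staircase) : col (x `&` y) = minn (col x) (col y).
Proof. exact: col_meet. Qed.
Lemma rowI (x y : staircase) : row (x `&` y) = minn (row x) (row y).
Proof. exact: row_meet. Qed.
Lemma colU (x y : staircase) : col (x `|` y) = maxn (col x) (col y).
Proof. exact: col_join. Qed.
Lemma rowU (x y : staircase) : row (x `|` y) =
  lift_row (maxn (col x) (col y)) (maxn (row x) (row y)).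
Proof. exact: row_join. Qed.

End Staircase.

(** * The staircase with diamonds: planarity and 3-modularity *)
Section Gadgets.
Variables (n K : nat) (p q : nat -> nat).
Hypothesis pq : forall k, (k < K)%N -> (p k < q k < n)%N.

Local Notation S := (staircase n K q).
Local Notation pt := (@pt n K q).

(** The color of the edges from row j to row j+1. *)
Definition color (j : nat) : nat := if odd j then p j./2 else q j./2.

Lemma color_lt j : (j < K.*2)%N -> (color j < n)%N.
Proof.
move=> hj; have hk : (j./2 < K)%N by lia.
by move: (pq hk); rewrite /color; case: ifP; lia.
Qed.

(** The cell of row edge j lies in column color j, where both of its sides have
    the color of the edge.  For even j the point above and to the right of the
    cell has been removed, and lift_row replaces it by the point one row up. *)
Definition cell_bot (j : 'I_K.*2) : S := pt (color j) j.
Definition cell_top (j : 'I_K.*2) : S :=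
  pt (color j).+1 (lift_row q (color j).+1 j.+1).

Lemma cell_bot_in (j : 'I_K.*2) : in_staircase n K q (color j) j.
Proof.
have hj := ltn_ord j; have hk : (j./2 < K)%N by lia.
rewrite /in_staircase (ltnW (color_lt hj)) (ltnW hj) /=.
by rewrite /removed /color; case: ifP => //=; move: (pq hk); lia.
Qed.

Lemma cell_right_in (j : 'I_K.*2) : in_staircase n K q (color j).+1 j.
Proof.
have hj := ltn_ord j; have hk : (j./2 < K)%N by lia.
rewrite /in_staircase (color_lt hj) (ltnW hj) /=.
by rewrite /removed /color; case: ifP => //=; move: (pq hk); lia.
Qed.

Lemma cell_left_in (j : 'I_K.*2) : in_staircase n K q (color j) j.+1.
Proof.
have hj := ltn_ord j; have hk : (j./2 < K)%N by lia.
rewrite /in_staircase (ltnW (color_lt hj)) hj /removed /= uphalf_half /color.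
by case: (boolP (odd j)) => //= _; rewrite ltnn.
Qed.

Lemma cell_top_in (j : 'I_K.*2) :
  in_staircase n K q (color j).+1 (lift_row q (color j).+1 j.+1).
Proof. exact: lift_row_in (color_lt (ltn_ord j)) (ltn_ord j). Qed.

Lemma cell_bot_lt_top j : cell_bot j < cell_top j.
Proof.
have hb := cell_bot_in j; have ht := cell_top_in j.
have ne : cell_bot j != cell_top j.
  by apply/eqP=> /(congr1 (@col n K q)); rewrite !col_pt //; lia.
rewrite lt_neqAle ne staircase_leE !col_pt ?row_pt //.
by rewrite leqnSn /lift_row; case: ifP; lia.
Qed.

Local Notation L := (inserted cell_bot_lt_top).

Local Notation floor := (@floor _ _ _ cell_bot cell_top cell_bot_lt_top).
Local Notation ceil := (@ceil _ _ _ cell_bot cell_top cell_bot_lt_top).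

(** An inserted element is placed inside its cell.  Columns are widened to 2K+1
    steps, so that the elements inserted in one column can be placed further to
    the left the higher they are, which makes them incomparable. *)
Definition xpos (x : L) : nat :=
  match x with
  | inl s => col s * K.*2.+1
  | inr j => color j * K.*2.+1 + (K.*2 - j)
  end.
Definition ypos (x : L) : nat :=
  match x with inl s => (row s).*2 | inr j => j.*2.+1 end.

Local Notation W := K.*2.+1.

Lemma xpos_floor x : (col (floor x) * W <= xpos x < (col (floor x)).+1 * W)%N.
Proof.
case: x => [s|j] /=; first by rewrite leqnn mulSn; lia.
by rewrite col_pt ?cell_bot_in // !mulSn; have := ltn_ord j; lia.
Qed.

Lemma ypos_floor x : ((row (floor x)).*2 <= ypos x < (row (floor x)).+1.*2)%N.
Proof.
case: x => [s|j] /=; first by lia.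
by rewrite row_pt ?cell_bot_in //; lia.
Qed.

Lemma cell_top_le (j : 'I_K.*2) (s : S) :
  (cell_top j <= s) = (color j < col s)%N && (j < row s)%N.
Proof.
rewrite staircase_leE col_pt ?row_pt ?cell_top_in //.
by case: leqP => //= h; rewrite lift_row_le.
Qed.

Lemma plane_order (x y : L) :
  (x <= y) = (xpos x <= xpos y)%N && (ypos x <= ypos y)%N.
Proof.
have leW a b e : (e < W)%N -> (a * W <= b * W + e)%N = (a <= b)%N.
  move=> he; apply/idP/idP => [|h].
    by rewrite -ltnS -addSn => ?; rewrite leqNgt; apply/negP => ab; nia.
  by rewrite (leq_trans _ (leq_addr _ _)) ?leq_pmul2r.
have mulW a b : (a * W <= b * W)%N = (a <= b)%N by rewrite leq_pmul2r.
case: x y => [s|j] [t|j'].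
- by rewrite [LHS](old_le (inl t : L) s) /= staircase_leE mulW; lia.
- rewrite [LHS](old_le (inr j' : L) s) /= staircase_leE.
  by rewrite col_pt ?row_pt ?cell_bot_in // leW; lia.
- rewrite [LHS](le_old (inr j : L) t) /= cell_top_le.
  have -> : (color j * W + (K.*2 - j) <= col t * W)%N = (color j < col t)%N.
    rewrite -[in RHS]mulW mulSn; apply/idP/idP; last by lia.
    have hj := ltn_ord j.
    by move=> h; rewrite -mulSn mulW ltnNge -(mulW (col t)); lia.
  by congr (_ && _); lia.
- rewrite [LHS](inserted_leE (inr j : L) (inr j')) /= cell_top_le.
  rewrite col_pt ?row_pt ?cell_bot_in //.
  have hj := ltn_ord j; have hj' := ltn_ord j'.
  have -> : ((inr j : L) == inr j') = (j == j' :> nat) by [].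
  have [->|ne] := eqVneq (j : nat) j'; first by rewrite !leqnn.
  have [c|c] := ltnP (color j) (color j').
    have := mulW (color j).+1 (color j'); rewrite c mulSn; lia.
  have := mulW (color j') (color j); rewrite c; lia.
Qed.

Lemma gadget_planar (R : realType) : planar R L.
Proof.
apply: (@planar_of_plane_embedding R _ L
  (fun x => (xpos x)%:R%R) (fun x => (ypos x)%:R%R)) => x y.
by rewrite !ler_nat; exact: plane_order.
Qed.

Lemma gadget_3modular : n_modular 3 L.
Proof.
apply: (@n_modular3_plane _ L xpos ypos plane_order (fun x => old _ (floor x))).
- by move=> x; rewrite old_le.
- exact: meet_le_floor.
- move=> x y nxy xy; rewrite meet_incomparable //= colI leq_pmul2r //.
  by have := xpos_floor x; have := xpos_floor y; nia.
- move=> x y nxy xy; rewrite meet_incomparable //= rowI.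
  by have := ypos_floor x; have := ypos_floor y; lia.
Qed.

End Gadgets.

(** * Congruences of chains given by a set of edges *)
Section Outside.
Variable P : pred nat.

(** Two points of a chain are related by the congruence collapsing the edges in
    P exactly if they have the same number of edges outside P below them. *)
Definition outside (a : nat) : nat := \sum_(i < a) ~~ P i.

Lemma outsideS a : outside a.+1 = (outside a + ~~ P a)%N.
Proof. exact: big_ord_recr. Qed.

Lemma outside_mono a b : (a <= b)%N -> (outside a <= outside b)%N.
Proof.
move=> ab; rewrite -(subnKC ab); elim: (b - a)%N => [|k IH].
  by rewrite addn0.
by rewrite addnS outsideS (leq_trans IH) ?leq_addr.
Qed.

Lemma outside_lt a b : ~~ P a -> (a < b)%N = (outside a < outside b)%N.
Proof.
move=> Pa; apply/idP/idP => [/outside_mono|].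
  by rewrite outsideS Pa addn1.
by apply: contraTT; rewrite -!leqNgt; exact: outside_mono.
Qed.

Lemma outside_fixed a b : ~~ P a -> outside a.+1 = outside b -> (a < b)%N.
Proof. by move=> Pa e; rewrite outside_lt // -e outsideS Pa addn1. Qed.

Lemma outside_maxn a b : outside (maxn a b) = maxn (outside a) (outside b).
Proof.
by case: (leqP a b) => [|/ltnW] /outside_mono h;
  [rewrite (maxn_idPr h) | rewrite (maxn_idPl h)].
Qed.

Lemma outside_minn a b : outside (minn a b) = minn (outside a) (outside b).
Proof.
by case: (leqP a b) => [|/ltnW] /outside_mono h;
  [rewrite (minn_idPl h) | rewrite (minn_idPr h)].
Qed.

End Outside.

Section ChainCongruence.
Context (d : Order.disp_t) (L : finLatticeType d) (E : {set L * L}).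
Hypothesis congE : is_congruence E.
Variables (P : pred nat) (N : nat) (f : nat -> L).

Lemma outside_related :
  (forall i, (i < N)%N -> P i -> (f i, f i.+1) \in E) ->
  forall a b, (a <= N)%N -> (b <= N)%N -> outside P a = outside P b ->
  (f a, f b) \in E.
Proof.
move=> h; suff up a b : (a <= b)%N -> (b <= N)%N -> outside P a = outside P b ->
    (f a, f b) \in E.
  move=> a b ha hb e; case/orP: (leq_total a b) => ab; first exact: up.
  by apply: cong_sym => //; exact: up.
move=> ab; rewrite -(subnKC ab); elim: (b - a)%N => [|k IH] hb e.
  by rewrite addn0; exact: cong_refl.
rewrite addnS in hb e *.
have Pk : P (a + k)%N.
  apply: contraT => nP; have := outside_mono P (leq_addr k a).
  by rewrite e outsideS nP; lia.
apply: (cong_trans congE (y := f (a + k)%N)); last exact: h.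
by apply: IH; rewrite ?(ltnW hb) // e outsideS Pk addn0.
Qed.

Lemma related_outside :
  (forall a b, (a <= b)%N -> (b <= N)%N -> f a <= f b) ->
  (forall i, (i < N)%N -> (f i, f i.+1) \in E -> P i) ->
  forall a b, (a <= N)%N -> (b <= N)%N -> (f a, f b) \in E ->
  outside P a = outside P b.
Proof.
move=> fmono h; suff up a b : (a <= b)%N -> (b <= N)%N -> (f a, f b) \in E ->
    outside P a = outside P b.
  move=> a b ha hb e; case/orP: (leq_total a b) => ab; first exact: up.
  by apply/esym; apply: up => //; exact: cong_sym.
move=> ab hb e; have {h} h i : (a <= i < b)%N -> P i.
  move=> /andP[ai ib]; apply: h; first exact: leq_trans ib hb.
  have bE c : (a <= c)%N -> (c <= b)%N -> f a <= f c <= f b.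
    by move=> ac cb; rewrite !fmono // (leq_trans cb hb).
  have /andP[x1 x2] := bE i ai (ltnW ib).
  have /andP[y1 y2] := bE i.+1 (leqW ai) ib.
  exact: (cong_interval congE x1 x2 y1 y2 e).
rewrite -(subnKC ab) in h *; elim: (b - a)%N h => [|k IH] h.
  by rewrite addn0.
rewrite addnS outsideS h ?addn0; last by rewrite leq_addr addnS leqnn.
by apply: IH => i /andP[ai ib]; apply: h; rewrite ai addnS ltnS ltnW.
Qed.

End ChainCongruence.

(** * Collapsed colors *)
Section Diamond.
Context (d : Order.disp_t) (L : finLatticeType d) (E : {set L * L}).
Hypothesis congE : is_congruence E.

(** In a diamond, an atom a identified with the bottom is pushed up by b to
    identify b and t, then down by c to identify o and c, and up again by a. *)
Lemma diamond_collapse (o t a b c : L) :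
  a `|` b = t -> a `|` c = t -> b `&` c = o -> c `&` t = c -> 
  o <= a -> o <= b ->
  (o, a) \in E -> (o, t) \in E.
Proof.
move=> ab ac bc ct oa ob h.
have bt : (b, t) \in E by move: (cong_joinr congE b h); rewrite ab (join_r ob).
have oc : (o, c) \in E by move: (cong_meetr congE c bt); rewrite bc meetC ct.
have at_ : (a, t) \in E.
  by move: (cong_joinl congE a oc); rewrite ac (join_l oa).
exact: cong_trans h at_.
Qed.

End Diamond.

Section GadgetCongruences.
Variables (n K : nat) (p q : nat -> nat).
Hypothesis pq : forall k, (k < K)%N -> (p k < q k < n)%N.

Local Notation S := (staircase n K q).
Local Notation pt := (@pt n K q).
Local Notation color := (color p q).
Local Notation bot := (@cell_bot n K p q).
Local Notation top := (@cell_top n K p q).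
Local Notation lohi := (cell_bot_lt_top pq).
Local Notation L := (inserted lohi).
Local Notation old := (old lohi).
Local Notation new := (new lohi).

Definition bottom_pt (i : nat) : L := old (pt i 0).
Definition left_pt (j : nat) : L := old (pt 0 j).

Lemma bottom_in i : (i <= n)%N -> in_staircase n K q i 0.
Proof. by rewrite /in_staircase => ->. Qed.

Lemma left_in j : (j <= K.*2)%N -> in_staircase n K q 0 j.
Proof. by rewrite /in_staircase /removed ltn0 andbF => ->. Qed.

Lemma bottom_mono i i' : (i <= i')%N -> (i' <= n)%N ->
  bottom_pt i <= bottom_pt i'.
Proof.
move=> ii hi; rewrite old_le staircase_leE.
by rewrite !col_pt ?row_pt ?bottom_in ?(leq_trans ii hi) ?ii.
Qed.

Lemma left_mono j j' : (j <= j')%N -> (j' <= K.*2)%N -> left_pt j <= left_pt j'.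
Proof.
move=> jj hj; rewrite old_le staircase_leE.
by rewrite !col_pt ?row_pt ?left_in ?(leq_trans jj hj) ?jj.
Qed.

(** The candidate congruence collapsing a set I of colors: coordinatewise on the
    staircase, and extended to the inserted elements. *)
Section Theta.
Variable I : pred nat.

Definition theta_base : {set S * S} :=
  [set xy | (outside I (col xy.1) == outside I (col xy.2)) &&
   (outside (I \o color) (row xy.1) == outside (I \o color) (row xy.2))].

Definition theta : {set L * L} := extension lohi theta_base.

Lemma theta_baseP x y : reflect
  (outside I (col x) = outside I (col y) /\
   outside (I \o color) (row x) = outside (I \o color) (row y))
  ((x, y) \in theta_base).
Proof. by rewrite inE; apply: (iffP andP) => [[/eqP ? /eqP]|[-> ->]]. Qed.

Hypothesis closedI : forall k, (k < K)%N -> I (q k) -> I (p k).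

Let h := outside I.
Let g := outside (I \o color).

(** A removed point whose upper edge is not collapsed cannot be moved within its
    class: the color p k of its upper edge is not in I, so the color q k of its
    lower edge and of the column where its row ends is not in I either.  Hence
    its class contains no other row, and no column on the other side of q k. *)
Lemma lift_row_unabsorbed i j i' j' : (j <= K.*2)%N -> removed q i j ->
  ~~ I (p j./2) -> h i = h i' -> g j = g j' -> removed q i' j' /\ j' = j.
Proof.
move=> hj /andP[oj qi] nIp hi gj.
have kK : (j./2 < K)%N by lia.
have nIq : ~~ I (q j./2) by apply: contra nIp; exact: closedI.
have jj' : j' = j.
  have nc : ~~ (I \o color) j by rewrite /= /color oj.
  have nc' : ~~ (I \o color) j.-1.
    rewrite /= /color (_ : odd j.-1 = false); last by lia.
    by rewrite (_ : j.-1./2 = j./2) //; lia.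
  have := outside_lt j' nc; have := outside_lt j' nc'; have := outside_lt j nc'.
  rewrite -/g gj; lia.
split=> //; rewrite jj' /removed oj /= (outside_lt _ nIq) -/h -hi.
by rewrite /h -outside_lt.
Qed.

Lemma lift_row_absorbed i j : removed q i j -> I (p j./2) ->
  g (lift_row q i j) = g j.
Proof.
move=> r Ip; rewrite /lift_row r /g outsideS /= /color.
by case/andP: r => -> _; rewrite Ip addn0.
Qed.

(** Compatibility of joins in the staircase with the candidate congruence. *)
Lemma lift_row_outside i j i' j' : (j <= K.*2)%N -> (j' <= K.*2)%N ->
  h i = h i' -> g j = g j' -> g (lift_row q i j) = g (lift_row q i' j').
Proof.
move=> hj hj' hi gj.
have lift_g i0 j0 : removed q i0 j0 && ~~ I (p j0./2) = false ->
    g (lift_row q i0 j0) = g j0.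
  move=> e; have [r|nr] := boolP (removed q i0 j0); last first.
    by rewrite /lift_row (negbTE nr).
  by apply: lift_row_absorbed => //; move: e; rewrite r /= => /negbFE.
have [/andP[r nI]|ok] := boolP (removed q i j && ~~ I (p j./2)).
  have [r' e] := lift_row_unabsorbed hj r nI hi gj.
  by subst j'; rewrite /lift_row r r'.
have [/andP[r nI]|ok'] := boolP (removed q i' j' && ~~ I (p j'./2)).
  have [r' e] := lift_row_unabsorbed hj' r nI (esym hi) (esym gj).
  by subst j; rewrite r' nI in ok.
by rewrite !lift_g ?(negbTE ok) ?(negbTE ok').
Qed.

Lemma theta_base_congruence : is_congruence theta_base.
Proof.
apply/is_congruenceP; split.
- by move=> x; exact/theta_baseP.
- by move=> x y /theta_baseP[*]; exact/theta_baseP.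
- by move=> x y z /theta_baseP[a b] /theta_baseP[c e]; apply/theta_baseP;
    rewrite a b.
- move=> x y z /theta_baseP[hc hr]; apply/theta_baseP.
  by rewrite !colI !rowI !outside_minn hc hr.
- move=> x y z /theta_baseP[hc hr]; apply/theta_baseP.
  have /and3P[_ rx _] := in_staircaseP x.
  have /and3P[_ ry _] := in_staircaseP y.
  have /and3P[_ rz _] := in_staircaseP z.
  rewrite !colU !rowU !outside_maxn hc; split=> //.
  by apply: lift_row_outside; rewrite ?geq_max ?rx ?ry ?rz //
    /h /g !outside_maxn ?hc ?hr.
Qed.

Lemma cell_collapsed (j : 'I_K.*2) : I (color j) ->
  (bot j, top j) \in theta_base.
Proof.
move=> Ij; have hj := ltn_ord j; have kK : (j./2 < K)%N by lia.
apply/theta_baseP.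
rewrite !col_pt ?row_pt ?(cell_bot_in pq) ?(cell_top_in pq) //.
rewrite outsideS Ij addn0; split=> //.
have gS : g j.+1 = g j by rewrite /g outsideS /= Ij addn0.
rewrite -/g -gS; have [r|nr] := boolP (removed q (color j).+1 j.+1); last first.
  by rewrite /lift_row (negbTE nr).
rewrite lift_row_absorbed //.
case/andP: r => /= oj _; rewrite (_ : uphalf j = j./2); last by lia.
by apply: closedI => //; move: Ij; rewrite /color (negbTE oj).
Qed.

(** All staircase edges going up from the bottom of the cell or down from its
    top have the color of the cell.  The one exception is the edge going down from
    the top of an even cell: it skips a removed row, and only its lower half has
    that color, which is enough to separate its ends. *)
Lemma cell_tight (j : 'I_K.*2) : ~~ I (color j) ->
  (forall s, (s, bot j) \in theta_base -> s <= bot j) /\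
  (forall s, (s, top j) \in theta_base -> top j <= s).
Proof.
move=> nIj; split=> s /theta_baseP[].
  rewrite staircase_leE !col_pt ?row_pt ?(cell_bot_in pq) // => hc hr.
  rewrite leqNgt (outside_lt _ nIj) hc ltnn.
  by rewrite leqNgt (outside_lt (P := I \o color)) ?hr ?ltnn.
rewrite (cell_top_le pq) !col_pt ?row_pt ?(cell_top_in pq) // => hc hr.
rewrite (outside_fixed nIj) //=.
rewrite (outside_lt (P := I \o color)) // hr.
have : (j < lift_row q (color j).+1 j.+1)%N by rewrite /lift_row; case: ifP.
by rewrite (outside_lt (P := I \o color)).
Qed.

Lemma theta_congruence : is_congruence theta.
Proof.
apply: extension_congruence; first exact: theta_base_congruence.
by move=> j; have [/cell_collapsed|/cell_tight] := boolP (I (color j));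
  [left | right].
Qed.

Lemma theta_bottom i : (i < n)%N ->
  ((bottom_pt i, bottom_pt i.+1) \in theta) = I i.
Proof.
move=> hi; rewrite extensionE !(flat_old _ theta_base_congruence) /=.
have -> : (bottom_pt i == bottom_pt i.+1) = false.
  apply/eqP=> -[/(congr1 (@col n K q))].
  by rewrite !col_pt ?bottom_in ?(ltnW hi) //; lia.
apply/theta_baseP/idP; rewrite !col_pt ?row_pt ?bottom_in ?(ltnW hi) //.
  by rewrite outsideS; case: (I i) => //= -[]; lia.
by rewrite outsideS => ->; rewrite addn0.
Qed.

End Theta.

(** Conversely, a congruence is recovered from the colors that it collapses. *)
Section Recover.
Variable E : {set L * L}.
Hypothesis congE : is_congruence E.

Definition collapsed : pred nat :=
  [pred i | (bottom_pt i, bottom_pt i.+1) \in E].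

Lemma pt_meet i j i' j' : in_staircase n K q i j -> in_staircase n K q i' j' ->
  old (pt i j) `&` old (pt i' j') = old (pt (minn i i') (minn j j')).
Proof.
move=> h h'; rewrite meet_old; congr inl; apply: staircase_eq.
  by rewrite colI !col_pt // in_staircase_min.
by rewrite rowI !row_pt // in_staircase_min.
Qed.

Lemma pt_join i j i' j' : in_staircase n K q i j -> in_staircase n K q i' j' ->
  old (pt i j) `|` old (pt i' j') =
  old (pt (maxn i i') (lift_row q (maxn i i') (maxn j j'))).
Proof.
move=> h h'.
have hm : in_staircase n K q (maxn i i') (lift_row q (maxn i i') (maxn j j')).
  by case/and3P: h => ? ? _; case/and3P: h' => ? ? _; apply: lift_row_in; lia.
rewrite join_old; congr inl; apply: staircase_eq.
  by rewrite colU !col_pt.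
by rewrite rowU !col_pt // !row_pt.
Qed.

Lemma lift_row_id i j : in_staircase n K q i j -> lift_row q i j = j.
Proof. by case/and3P=> _ _ /negbTE; rewrite /lift_row => ->. Qed.

(** The diamond of one cell, with bottom o, top t, and atoms a on the left side,
    r on the right side, and the inserted m. *)
Section Cell.
Variable j : 'I_K.*2.

Let c := color j.
Let o : L := old (bot j).
Let t : L := old (top j).
Let a : L := old (pt c j.+1).
Let r : L := old (pt c.+1 j).
Let m : L := new j.

Let in_o := cell_bot_in pq j.
Let in_a := cell_left_in pq j.
Let in_r := cell_right_in pq j.
Let in_t := cell_top_in pq j.

Let joinar : a `|` r = t.
Proof.
rewrite /a /r pt_join // (maxn_idPr (leqnSn c)).
by rewrite (maxn_idPl (leqnSn j)).
Qed.

Let meetar : a `&` r = o.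
Proof.
by rewrite /a /r pt_meet // (minn_idPl (leqnSn c)) (minn_idPr (leqnSn j)).
Qed.

Let oa : o <= a. Proof. by rewrite -meetar leIl. Qed.
Let or_ : o <= r. Proof. by rewrite -meetar leIr. Qed.
Let at_ : a <= t. Proof. by rewrite -joinar leUl. Qed.
Let rt : r <= t. Proof. by rewrite -joinar leUr. Qed.
Let om : o <= m. Proof. by rewrite old_le. Qed.
Let mt : m <= t. Proof. by rewrite le_old. Qed.

Let am : a >< m.
Proof.
rewrite /Order.comparable negb_or le_old old_le (cell_top_le pq) col_pt //.
by rewrite ltnn staircase_leE !row_pt // ltnn andbF.
Qed.

Let rm : r >< m.
Proof.
rewrite /Order.comparable negb_or le_old old_le (cell_top_le pq) row_pt //.
by rewrite ltnn andbF staircase_leE !col_pt // ltnn.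
Qed.

Let joinam : a `|` m = t.
Proof.
rewrite join_incomparable //; congr inl; apply: join_r.
by move: at_; rewrite old_le.
Qed.
Let joinrm : r `|` m = t.
Proof.
rewrite join_incomparable //; congr inl; apply: join_r.
by move: rt; rewrite old_le.
Qed.
Let meetam : a `&` m = o.
Proof.
rewrite meet_incomparable //; congr inl; apply: meet_r.
by move: oa; rewrite old_le.
Qed.
Let meetrm : r `&` m = o.
Proof.
rewrite meet_incomparable //; congr inl; apply: meet_r.
by move: or_; rewrite old_le.
Qed.

Let collapse_a : (o, a) \in E -> (o, t) \in E.
Proof.
exact: (diamond_collapse congE joinar joinam meetrm (meet_l mt) oa or_).
Qed.

Let collapse_r : (o, r) \in E -> (o, t) \in E.
Proof.
have joinra : r `|` a = t by rewrite joinC.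
exact: (diamond_collapse congE joinra joinrm meetam (meet_l mt) or_ oa).
Qed.

Let collapse_m : (o, m) \in E -> (o, t) \in E.
Proof.
have joinma : m `|` a = t by rewrite joinC.
have joinmr : m `|` r = t by rewrite joinC.
exact: (diamond_collapse congE joinma joinmr meetar (meet_l rt) om oa).
Qed.

Lemma bottom_collapses_cell : collapsed c -> (o, t) \in E.
Proof.
move=> /(cong_joinr congE o); rewrite /bottom_pt /o /cell_bot.
have [hc _ _] := and3P in_r.
rewrite !pt_join ?bottom_in ?(ltnW hc) // !max0n maxnn (maxn_idPl (leqnSn c)).
by rewrite !lift_row_id //; exact: collapse_r.
Qed.

Lemma left_collapses_cell : (left_pt j, left_pt j.+1) \in E -> (o, t) \in E.
Proof.
move=> /(cong_joinr congE o); rewrite /left_pt /o /cell_bot.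
have hj := ltn_ord j.
rewrite !pt_join ?left_in ?(ltnW hj) // !max0n maxnn (maxn_idPl (leqnSn j)).
by rewrite !lift_row_id //; exact: collapse_a.
Qed.

Lemma cell_collapses_bottom : (o, t) \in E -> collapsed c.
Proof.
move=> ot; have [hc _ _] := and3P in_r.
have : (o, r) \in E.
  exact: (cong_interval congE (lexx o) (le_trans or_ rt) or_ rt ot).
move=> /(cong_meetr congE (bottom_pt c.+1)); rewrite /bottom_pt /o /r /cell_bot.
by rewrite !pt_meet ?bottom_in // !minn0 minnn (minn_idPl (leqnSn c)).
Qed.

Lemma cell_collapses_left : (o, t) \in E -> (left_pt j, left_pt j.+1) \in E.
Proof.
move=> ot; have hj := ltn_ord j.
have : (o, a) \in E.
  exact: (cong_interval congE (lexx o) (le_trans oa at_) oa at_ ot).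
move=> /(cong_meetr congE (left_pt j.+1)); rewrite /left_pt /o /a /cell_bot.
by rewrite !pt_meet ?left_in // !minn0 minnn (minn_idPl (leqnSn j)).
Qed.

(** Identifying m with another element identifies it with its lower or its upper
    cover, which collapses the diamond. *)
Lemma new_collapses_cell y : (m, y) \in E -> y != m -> (o, t) \in E.
Proof.
move=> my ym; have [le_my|nle] := boolP (m <= y).
  have ty : t <= y.
    rewrite old_le; move: le_my; rewrite inserted_leE => /orP[/eqP e|//].
    by rewrite -e eqxx in ym.
  have mt' := cong_interval congE (lexx m) (le_trans mt ty) mt ty my.
  apply: collapse_a; move: (cong_meetl congE a mt').
  by rewrite meetam (meet_l at_).
apply: collapse_m.
have ymm : (m `&` y, m) \in E.
  by move: (cong_meetl congE m my) => /(cong_sym congE); rewrite meetxx.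
apply: (cong_interval congE _ om _ (lexx m) ymm); last exact: leIl.
exact: (meet_le_floor nle).
Qed.

End Cell.

(** Collapsing q k collapses the cell of row 2k, whose left side runs from row
    2k to row 2k+2 and contains the row edge of color p k. *)
Lemma collapsed_closed k : (k < K)%N -> collapsed (q k) -> collapsed (p k).
Proof.
move=> hk; have h0 : (k.*2 < K.*2)%N by lia.
have h1 : (k.*2.+1 < K.*2)%N by lia.
have c0 : color k.*2 = q k by rewrite /color odd_double doubleK.
have c1 : color k.*2.+1 = p k by rewrite /color /= odd_double /= uphalf_double.
rewrite -c0 -c1 => /(bottom_collapses_cell (j := Ordinal h0)) ot.
apply: (cell_collapses_bottom (j := Ordinal h1)).
apply: left_collapses_cell => /=.
have hb := cell_bot_in pq (Ordinal h0); have ht := cell_top_in pq (Ordinal h0).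
move: (cong_meetr congE (left_pt k.*2.+2) ot); rewrite /left_pt.
have topE : lift_row q (color k.*2).+1 k.*2.+1 = k.*2.+2.
  by rewrite /lift_row /removed /= odd_double /= uphalf_double c0 leqnn.
rewrite /cell_bot /cell_top !pt_meet ?left_in // topE !minn0 minnn.
rewrite (minn_idPl (_ : k.*2 <= k.*2.+2)%N); last by rewrite ltnW.
have hk2 : (k.*2.+2 <= K.*2)%N by [].
apply: cong_interval => //.
- exact: left_mono (leqnSn _) (ltnW hk2).
- exact: left_mono (leqnSn _) hk2.
- exact: left_mono (ltnW (leqnSn _)) hk2.
Qed.

(** Every staircase point is the join of a bottom point and a left point, so it
    suffices to collapse these two chains. *)
Lemma theta_sub (I : pred nat) : (forall i, (i < n)%N -> I i -> collapsed i) ->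
  theta I \subset E.
Proof.
move=> IE.
have related (s u : S) : (s, u) \in theta_base I -> (old s, old u) \in E.
  have split_pt x : old x = bottom_pt (col x) `|` left_pt (row x).
    have hx := in_staircaseP x; have [hc hr _] := and3P hx.
    rewrite /bottom_pt /left_pt pt_join ?bottom_in ?left_in //.
    by rewrite maxn0 max0n lift_row_id // pt_eta.
  have [hc hr _] := and3P (in_staircaseP s).
  have [hc' hr' _] := and3P (in_staircaseP u).
  case/theta_baseP=> ec er; rewrite !split_pt; apply: cong_join2 => //.
    exact: (outside_related congE (f := bottom_pt) IE).
  apply: (outside_related congE (f := left_pt) (N := K.*2)) er => // j hj Ij.
  apply: (cell_collapses_left (j := Ordinal hj)); apply: bottom_collapses_cell.
  by apply: IE => //; exact: (color_lt pq).
have to_floor (x : L) : flat (theta_base I) x -> (x, old (floor x)) \in E.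
  move=> /related fx; have x1 : old (floor x) <= x by rewrite old_le.
  have x2 : x <= old (ceil x) by rewrite le_old.
  exact: (cong_interval congE x1 x2 (lexx _) (le_trans x1 x2) fx).
apply/subsetP=> -[x y]; rewrite extensionE => /orP[/eqP->|/and3P[fx fy xy]].
  exact: cong_refl.
apply: (cong_trans congE (to_floor x fx)).
apply: (cong_trans congE (related _ _ xy)).
by apply: cong_sym => //; exact: to_floor.
Qed.

(** Meeting with the last bottom point or the last left point projects related
    points to related points of the two chains. *)
Lemma sub_theta : E \subset theta collapsed.
Proof.
have base (s u : S) : (old s, old u) \in E -> (s, u) \in theta_base collapsed.
  move=> su; have [hc hr _] := and3P (in_staircaseP s).
  have [hc' hr' _] := and3P (in_staircaseP u).
  apply/theta_baseP; split.
    apply: (related_outside congE bottom_mono _ hc hc') => //.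
    have meetE x : old x `&` bottom_pt n = bottom_pt (col x).
      have hx := in_staircaseP x; have [? _ _] := and3P hx.
      rewrite -{1}[x]pt_eta /bottom_pt pt_meet ?bottom_in //.
      by rewrite minn0 (minn_idPl _).
    by rewrite -!meetE; exact: cong_meetr.
  apply: (related_outside congE left_mono _ hr hr') => //.
    move=> j hj /(left_collapses_cell (j := Ordinal hj)).
    exact: cell_collapses_bottom.
  have meetE x : old x `&` left_pt K.*2 = left_pt (row x).
    have hx := in_staircaseP x; have [_ ? _] := and3P hx.
    rewrite -{1}[x]pt_eta /left_pt pt_meet ?left_in //.
    by rewrite minn0 (minn_idPl _).
  by rewrite -!meetE; exact: cong_meetr.
have flatE (x y : L) : (x, y) \in E -> x != y ->
    (x, old (floor x)) \in E /\ (old (floor x), old (ceil x)) \in E.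
  case: x => [x|j] xy ne; first by split; exact: cong_refl.
  have ot : (old (bot j), old (top j)) \in E.
    by apply: new_collapses_cell xy _; rewrite eq_sym.
  split=> //; apply: (cong_interval congE _ _ _ _ ot).
  - by rewrite old_le.
  - by rewrite le_old.
  - exact: lexx.
  - rewrite old_le; exact: ltW (lohi j).
apply/subsetP=> -[x y] xy; rewrite extensionE.
have [//|ne /=] := eqVneq x y.
have [x1 x2] := flatE _ _ xy ne.
have [y1 y2] : (y, old (floor y)) \in E /\ (old (floor y), old (ceil y)) \in E.
  by apply: flatE (cong_sym congE xy) _; rewrite eq_sym.
rewrite /flat !base //.
apply: (cong_trans congE (cong_sym congE x1)).
exact: (cong_trans congE xy y1).
Qed.

End Recover.
End GadgetCongruences.

(** * Representing a distributive lattice *)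
Lemma lattice_isomorphic_of_order_iso (d1 d2 : Order.disp_t)
    (L1 : latticeType d1) (L2 : latticeType d2) (f : L1 -> L2) (g : L2 -> L1) :
  cancel f g -> cancel g f ->
  {homo f : x y / x <= y} -> {homo g : x y / x <= y} ->
  lattice_isomorphic L1 L2.
Proof.
move=> fK gK fmono gmono.
have fle x y : (f x <= y) = (x <= g y).
  by apply/idP/idP => [/gmono|/fmono]; rewrite ?fK ?gK.
have lef x y : (y <= f x) = (g y <= x).
  by apply/idP/idP => [/gmono|/fmono]; rewrite ?fK ?gK.
have fI : {morph f : x y / x `&` y}.
  move=> x y; have E z : (z <= f (x `&` y)) = (z <= f x `&` f y).
    by rewrite lexI !lef lexI.
  by apply/le_anti; rewrite -E lexx E lexx.
have fU : {morph f : x y / x `|` y}.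
  move=> x y; have E z : (f (x `|` y) <= z) = (f x `|` f y <= z).
    by rewrite leUx !fle leUx.
  by apply/le_anti; rewrite E lexx -E lexx.
pose fO := Order.isOrderMorphism.Build _ _ _ _ f fmono.
pose fM := Order.isMeetLatticeMorphism.Build _ _ _ _ f fI.
pose fJ := Order.isJoinLatticeMorphism.Build _ _ _ _ f fU.
pose F : {lmorphism L1 -> L2} := HB.pack f fO fM fJ.
by exists F; exists g.
Qed.

Section JoinIrreducibles.
Context (d : Order.disp_t) (D : finTBDistrLatticeType d).

Definition join_irreducible (x : D) : bool :=
  (x != \bot) && [forall y, forall z, (y `|` z == x) ==> (y == x) || (z == x)].

(** Distributivity turns x = x ^ (y v z) into a join representation of x. *)
Lemma join_irreducible_prime x (I : finType) (P : pred I) (F : I -> D) :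
  join_irreducible x -> x <= \join_(i | P i) F i ->
  exists2 i, P i & x <= F i.
Proof.
case/andP=> x0 /forallP irr xF.
suff : [exists i, P i && (x <= F i)] by case/existsP=> i /andP[]; exists i.
move: xF; apply: contraTT; rewrite negb_exists => /forallP nF.
elim/big_rec: _ => [|i y Pi IH]; first by rewrite lex0.
apply: contra IH => xy; have nxi : ~~ (x <= F i) by move: (nF i); rewrite Pi.
have := forallP (irr (x `&` F i)) (x `&` y).
rewrite -meetUr (meet_l xy) eqxx /= -!leEmeet (negbTE nxi).
done.
Qed.

Definition downset_card (x : D) : nat := #|[pred y | y <= x]|.

Lemma downset_card_lt x y : x < y -> (downset_card x < downset_card y)%N.
Proof.
move=> xy; apply: proper_card; apply/properP; split.
  by apply/subsetP=> z; rewrite !inE => /le_trans; apply; exact: ltW.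
by exists y; rewrite !inE ?lexx // lt_geF.
Qed.

Lemma le_join_irreducible x y :
  (forall z, join_irreducible z -> z <= x -> z <= y) -> x <= y.
Proof.
have [m] := ubnP (downset_card x); elim: m x => // m IH x xm zy.
have [irr|] := boolP (join_irreducible x); first exact: zy.
rewrite negb_and negbK => /orP[/eqP->|]; first exact: le0x.
case/forallPn=> a /forallPn[b]; rewrite negb_imply negb_or.
case/andP=> /eqP abx /andP[ax bx].
have below c : c != x -> c <= x -> c <= y.
  move=> cx cx'; apply: IH => [|z zi zc].
    rewrite -ltnS; apply: leq_trans xm.
    by rewrite ltnS downset_card_lt // lt_neqAle cx.
  by apply: zy => //; exact: le_trans cx'.
by rewrite -abx leUx !below // -abx ?leUl ?leUr.
Qed.

(** Sorting by the number of elements below gives a linear extension of the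
    order, as required by the staircase: p k < q k. *)
Definition irreducibles : seq D :=
  sort (relpre downset_card leq) (enum join_irreducible).

Local Notation n := (size irreducibles).
Local Notation s := (nth \bot irreducibles).

Lemma mem_irreducibles x : (x \in irreducibles) = join_irreducible x.
Proof. by rewrite mem_sort mem_enum. Qed.

Lemma irreducible_nth i : (i < n)%N -> join_irreducible (s i).
Proof. by move=> hi; rewrite -mem_irreducibles mem_nth. Qed.

Lemma irreducibles_increasing i j : (i < n)%N -> (j < n)%N ->
  s i < s j -> (i < j)%N.
Proof.
move=> hi hj /downset_card_lt lt_ij; rewrite ltnNge; apply/negP=> ji.
have tr : transitive (relpre downset_card leq).
  by move=> ? ? ?; exact: leq_trans.
have re : reflexive (relpre downset_card leq) by move=> ?; exact: leqnn.
have so : sorted (relpre downset_card leq) irreducibles.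
  by apply: sort_sorted => ? ?; exact: leq_total.
have := sorted_leq_nth tr re \bot so j i; rewrite !inE => /(_ hj hi ji) /=.
by rewrite leqNgt lt_ij.
Qed.

Definition strict_pairs : seq (nat * nat) :=
  [seq ij <- [seq (i, j) | i <- iota 0 n, j <- iota 0 n] | s ij.1 < s ij.2].

Local Notation K := (size strict_pairs).
Let p (k : nat) : nat := (nth (0, 0)%N strict_pairs k).1.
Let q (k : nat) : nat := (nth (0, 0)%N strict_pairs k).2.

Lemma mem_strict_pairs i j : ((i, j) \in strict_pairs) =
  [&& s i < s j, (i < n)%N & (j < n)%N].
Proof.
rewrite mem_filter /=; congr (_ && _).
apply/allpairsP/andP => [[[a b] /= []]|[hi hj]].
  by rewrite !mem_iota !add0n => ha hb [-> ->].
by exists (i, j); rewrite !mem_iota.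
Qed.

Lemma strict_pairsP k : (k < K)%N ->
  [&& s (p k) < s (q k), (p k < n)%N & (q k < n)%N].
Proof.
by move=> hk; rewrite -mem_strict_pairs -surjective_pairing mem_nth.
Qed.

Lemma pair_bounds k : (k < K)%N -> (p k < q k < n)%N.
Proof.
case/strict_pairsP/and3P=> lt_pq hp hq.
by rewrite hq irreducibles_increasing.
Qed.

Local Notation L := (inserted (cell_bot_lt_top pair_bounds)).

Definition below (x : D) : pred nat := [pred i | s i <= x].

Lemma below_closed x k : (k < K)%N -> below x (q k) -> below x (p k).
Proof.
by case/strict_pairsP/and3P=> /ltW lt_pq _ _; exact: le_trans.
Qed.

Definition cong_of (x : D) : congruence L :=
  Congruence (theta_congruence pair_bounds (@below_closed x)).

Lemma collapsed_cong_of x i : (i < n)%N ->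
  collapsed (cong_of x) i = below x i.
Proof. by apply: theta_bottom; exact: below_closed. Qed.

Definition elt_of (E : congruence L) : D :=
  \join_(i < n | collapsed E i) s i.

Let irreducible_le_join (P : pred nat) i : (i < n)%N -> P i ->
  s i <= \join_(j < n | P j) s j.
Proof.
by move=> hi; exact: (@joins_sup _ _ _ (Ordinal hi) _ (fun j : 'I_n => s j)).
Qed.

Lemma below_elt_of E i : (i < n)%N -> below (elt_of E) i = collapsed E i.
Proof.
move=> hi; apply/idP/idP => [|h]; last exact: irreducible_le_join.
(* A join-irreducible element below the join is below a collapsed color, and
   the collapsed colors form a down-set. *)
case/(join_irreducible_prime (irreducible_nth hi)) => j cj.
rewrite le_eqVlt => /orP[/eqP e|ij].
  have : uniq irreducibles by rewrite sort_uniq enum_uniq.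
  by move/(nth_uniq \bot hi (ltn_ord j)); rewrite e eqxx => /esym/eqP->.
have ijP : (i, val j) \in strict_pairs.
  by rewrite mem_strict_pairs ij hi ltn_ord.
have hk : (index (i, val j) strict_pairs < K)%N by rewrite index_mem.
have := collapsed_closed (congP E) hk.
by rewrite /p /q nth_index //; exact.
Qed.

Lemma cong_ofK : cancel cong_of elt_of.
Proof.
move=> x; apply/le_anti/andP; split.
  apply/joinsP=> i; by rewrite collapsed_cong_of.
apply: le_join_irreducible => z zi zx.
have hz : z \in irreducibles by rewrite mem_irreducibles.
have hi : (index z irreducibles < n)%N by rewrite index_mem.
rewrite -(nth_index \bot hz); apply: irreducible_le_join => //.
by rewrite collapsed_cong_of // /below /= nth_index.
Qed.

Lemma elt_ofK : cancel elt_of cong_of.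
Proof.
move=> E; apply: val_inj; apply/eqP; rewrite eqEsubset; apply/andP; split.
  by apply: theta_sub (congP E) _ _ => i hi; rewrite below_elt_of.
apply: subset_trans (sub_theta (congP E)) _.
apply: theta_sub (congP (cong_of _)) _ _ => i hi ci.
by rewrite collapsed_cong_of // below_elt_of.
Qed.

Lemma elt_of_mono : {homo elt_of : E F / E <= F}.
Proof.
move=> E F /subsetP EF; apply/joinsP => i ci.
by apply: irreducible_le_join => //; exact: EF.
Qed.

Lemma cong_of_mono : {homo cong_of : x y / x <= y}.
Proof.
move=> x y xy; apply: theta_sub (congP (cong_of y)) _ _ => i hi ix.
by rewrite collapsed_cong_of //; exact: le_trans xy.
Qed.

End JoinIrreducibles.

Theorem corollary8p1 (R : realType) (d : Order.disp_t)
    (D : finTBDistrLatticeType d) :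
  exists (d' : Order.disp_t) (L : finTBLatticeType d'),
    [/\ planar R L, n_modular 3 L & lattice_isomorphic (congruence L) D].
Proof.
exists inserted_display, (inserted (cell_bot_lt_top (@pair_bounds d D))).
split; [exact: gadget_planar | exact: gadget_3modular |].
exact: lattice_isomorphic_of_order_iso (@elt_ofK d D) (@cong_ofK d D)
  (@elt_of_mono d D) (@cong_of_mono d D).
Qed.
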